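(* Run the Unbiased Space Saving sketch with $m$ bins on an i.i.d. stream of items drawn from a discrete distribution with probabilities $p_1 \ge p_2 \ge \cdots$ (item $j$ drawn with probability $p_j$). If $p_1 > 1/m$, then with probability $1$, $Z_1(t) = 1$ for all sufficiently large $t$.
   Context: Unbiased Space Saving sketch with $m$ bins: maintain $m$ (item, count) pairs, counts initialized to $0$. For each new row with item $x_{new}$: if $x_{new}$ is a label, increment its count by $1$; otherwise choose a pair with the smallest count $\hat{N}_{min}$ (uniformly at random among all pairs sharing the smallest count), increment its count by $1$, and with probability $1/(\hat{N}_{min}+1)$ replace its label by $x_{new}$. $Z_i(t)$ is the indicator that item $i$ is the label of some pair after $t$ rows have been processed. *)

(* Defs.v *)
From HB Require Import structures.
From mathcomp Require Import all_boot all_order all_algebra.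
From mathcomp Require Import all_classical all_reals all_analysis.
Set Implicit Arguments. Unset Strict Implicit. Unset Printing Implicit Defensive.
Import Order.TTheory GRing.Theory Num.Theory.
Local Open Scope classical_set_scope.
Local Open Scope ring_scope.

(* A sketch state: a list of m (label, count) pairs; [None] = no label yet. *)
Definition uss_state := seq (option nat * nat).

Definition uss_init (m : nat) : uss_state := nseq m (None, 0%N).

Definition uss_min (s : uss_state) : nat :=
  foldr minn (head 0%N (map snd s)) (map snd s).

(* One update of Unbiased Space Saving on the new item [x], driven by two
   auxiliary numbers [u v] (uniform on [0,1) in the random model):
   - if [x] is a label, its count is incremented;
   - otherwise, among the pairs with smallest count N_min (there are k of
     them, listed as [idxs]), the j-th one is chosen where j is the unique
     index with j/k <= u < (j+1)/k (uniform choice when u ~ U[0,1));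
     its count is incremented and its label is replaced by [x] iff
     v < 1/(N_min+1) (which has probability 1/(N_min+1) when v ~ U[0,1)). *)
Definition uss_step (R : realType) (s : uss_state) (x : nat) (u v : R)
  : uss_state :=
  if Some x \in map fst s then
    map (fun pr => if pr.1 == Some x then (pr.1, pr.2.+1) else pr) s
  else
    let Nmin := uss_min s in
    let idxs := [seq i <- iota 0 (size s) | (nth (None, 0%N) s i).2 == Nmin] in
    let k := size idxs in
    let j := find (fun j : nat => u < j.+1%:R / k%:R) (iota 0 k) in
    let i := nth 0%N idxs j in
    let old := nth (None, 0%N) s i in
    let lbl := if v < 1 / (Nmin.+1)%:R then Some x else old.1 in
    set_nth (None, 0%N) s i (lbl, Nmin.+1).

Fixpoint uss_run (R : realType) (m : nat) (x : nat -> nat) (u v : nat -> R)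
  (t : nat) : uss_state :=
  match t with
  | 0 => uss_init m
  | t'.+1 => uss_step (uss_run m x u v t') (x t') (u t') (v t')
  end.

Definition uss_Z (R : realType) (m : nat) (x : nat -> nat) (u v : nat -> R)
  (i t : nat) : bool :=
  Some i \in map fst (uss_run m x u v t).

(* Mutual independence of the whole family (X_t, U_t, V_t)_{t in nat}:
   the product rule holds for every finite initial block of times and
   every choice of (measurable) sets (taking full sets covers all finite
   subfamilies). *)
Definition stream_indep (d : measure_display) (T : measurableType d)
  (R : realType) (P : probability T R)
  (X : nat -> T -> nat) (U V : nat -> T -> R) : Prop :=
  forall (n : nat) (A : nat -> set nat) (B C : nat -> set R),
    (forall t, measurable (B t)) -> (forall t, measurable (C t)) ->
    P (\bigcap_(t in [set t | (t < n)%N])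
         (X t @^-1` A t `&` U t @^-1` B t `&` V t @^-1` C t)) =
    (\prod_(t < n) (P (X t @^-1` A t) * P (U t @^-1` B t)
                    * P (V t @^-1` C t)))%E.

Definition uniform01 (d : measure_display) (T : measurableType d)
  (R : realType) (P : probability T R) (W : T -> R) : Prop :=
  measurable_fun [set: T] W /\
  forall a : R, 0 <= a <= 1 -> P (W @^-1` [set y | y < a]) = a%:E.

(* Main.v *)
Require Import Defs.
From HB Require Import structures.
From mathcomp Require Import all_boot all_order all_algebra.
From mathcomp Require Import all_classical all_reals all_analysis.
From mathcomp Require Import measurable_realfun.
From mathcomp Require Import zify ring lra.
Import Order.TTheory GRing.Theory Num.Theory.
Local Open Scope classical_set_scope.
Local Open Scope ring_scope.

(** Let [N t] be the count of the bin labelled [y], or 0 when [y] is not a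
    label, where [y] has probability [p > 1/m].  The sketch is unbiased: the
    conditional expectation of [N (t+1)] is [N t + p].  Fix [1/m < q < p] and
    put [Y t = q t - N t].  The smallest count is at most [t/m], so whenever
    [y] is absent or lies in a smallest bin, [Y] is of order [t] both before and
    after the next step; in all other states [N] just adds a Bernoulli([p])
    variable.  Hence the function equal to [exp (l z)] for [z <= 0] and to
    [1 + l z] for [z >= 0] makes [Y] a supermartingale for small [l] and large
    [t]: the large jumps only happen where it is affine.  It loses
    [l (p - q)] whenever [Y t >= 1], so the probabilities of [Y t >= 1] are
    summable; by Borel-Cantelli [N t > q t - 1 > 0] eventually. *)

Set Implicit Arguments. Unset Strict Implicit.

(** * Deterministic sketch: smallest count, chosen bin, invariants *)

Lemma map_set_nth (S S' : Type) (f : S -> S') (x0 : S) (s : seq S) (i : nat)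
  (z : S) : map f (set_nth x0 s i z) = set_nth (f x0) (map f s) i (f z).
Proof.
elim: s i => [|a s IH] [|i] //=; last by rewrite IH.
by congr cons; elim: i => [|i IHi] //=; rewrite IHi.
Qed.

Lemma foldr_minn_le (a k : nat) (l : seq nat) :
  k \in l -> (foldr minn a l <= k)%N.
Proof.
elim: l => //= b l IH; rewrite inE => /orP[/eqP->|/IH h]; first exact: geq_minl.
by rewrite geq_min h orbT.
Qed.

Lemma foldr_minn_mem (a : nat) (l : seq nat) : foldr minn a l \in a :: l.
Proof.
elim: l => [|b l] /=; first by rewrite inE.
rewrite !inE => /orP[/eqP->|h].
  by rewrite /minn; case: ifP; rewrite eqxx ?orbT.
by rewrite /minn; case: ifP; rewrite ?eqxx ?h ?orbT.
Qed.

Lemma uss_min_le (s : uss_state) (pr : option nat * nat) :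
  pr \in s -> (uss_min s <= pr.2)%N.
Proof. by move=> prs; apply: foldr_minn_le; apply: map_f. Qed.

Lemma uss_min_mem (s : uss_state) :
  (0 < size s)%N -> uss_min s \in map snd s.
Proof.
case: s => // a s _; have := foldr_minn_mem a.2 (map snd (a :: s)).
by rewrite /uss_min inE => /orP[/eqP->|//]; rewrite /= mem_head.
Qed.

(** The bin chosen inside [uss_step], isolated so that its range and its measurability can be
    treated apart from the relabelling. *)
Definition uss_pick (R : realType) (s : uss_state) (u : R) : nat :=
  let idxs := [seq i <- iota 0 (size s)
                 | (nth (None, 0%N) s i).2 == uss_min s] in
  let k := size idxs in
  nth 0%N idxs (find (fun j : nat => u < j.+1%:R / k%:R) (iota 0 k)).

(** The minimum is attained, so there are [k > 0] candidates. Since [u < 1 = k/k], the last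
    candidate passes the test, so the search never runs off the list into the default value of
    [nth]. *)
Lemma uss_pickP (R : realType) (s : uss_state) (u : R) :
  (0 < size s)%N -> u < 1 ->
  (uss_pick s u < size s)%N /\
  (nth (None, 0%N) s (uss_pick s u)).2 = uss_min s.
Proof.
move=> s0 u1; rewrite /uss_pick; set idxs := [seq i <- _ | _].
have idx0 : (0 < size idxs)%N.
  have /(nthP 0%N)[i] := uss_min_mem s0; rewrite size_map => ltis /eqP.
  rewrite (nth_map (None, 0%N)) // => mini.
  suff : i \in idxs by case: idxs.
  by rewrite mem_filter mini mem_iota.
set j := find _ (iota _ _).
have : j \in iota 0 (size idxs).
  rewrite mem_iota /= -[X in (_ < X)%N](size_iota 0) -has_find; apply/hasP.
  exists (size idxs).-1; first by rewrite mem_iota prednK //=.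
  by rewrite prednK// divff// pnatr_eq0 -lt0n.
rewrite mem_iota/= => /(mem_nth 0%N).
by rewrite mem_filter mem_iota/= => /andP[/eqP-> ->].
Qed.

Lemma uss_stepE (R : realType) (s : uss_state) (x : nat) (u v : R) :
  uss_step s x u v =
  if Some x \in map fst s then
    map (fun pr => if pr.1 == Some x then (pr.1, pr.2.+1) else pr) s
  else set_nth (None, 0%N) s (uss_pick s u)
    (if v < 1 / (uss_min s).+1%:R then Some x
     else (nth (None, 0%N) s (uss_pick s u)).1, (uss_min s).+1).
Proof. by []. Qed.

(** Uniqueness concerns genuine labels only: [None] fills every bin at the start. The bound on the
    total count yields [m * uss_min s <= t]. *)
Definition uss_inv (m t : nat) (s : uss_state) : Prop :=
  [/\ size s = m, forall x, (count_mem (Some x) (map fst s) <= 1)%N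
    & (sumn (map snd s) <= t)%N].

(* A sum rather than a lookup: it is 0 when [y] is not a label. *)
Definition label_count (y : nat) (s : uss_state) : nat :=
  sumn [seq (if pr.1 == Some y then pr.2 else 0)%N | pr <- s].

Lemma label_count_out (y : nat) (s : uss_state) :
  Some y \notin map fst s -> label_count y s = 0%N.
Proof.
elim: s => //= a s IH; rewrite inE negb_or eq_sym => /andP[/negbTE ay /IH].
by rewrite /label_count /= ay add0n.
Qed.

Lemma label_count_bin (y : nat) (s : uss_state) (pr : option nat * nat) :
  (count_mem (Some y) (map fst s) <= 1)%N -> pr \in s -> pr.1 = Some y ->
  label_count y s = pr.2.
Proof.
move=> + + pry; elim: s => //= a s IH.
rewrite inE /label_count /= => c1 /orP[/eqP pra|prs].
  move: c1; rewrite -pra pry eqxx ltnS leqn0 => /eqP c0.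
  rewrite -/(label_count y s) label_count_out ?addn0//.
  by rewrite -has_pred1 has_count c0.
have : (0 < count_mem (Some y) (map fst s))%N.
  by rewrite -has_count has_pred1 -pry map_f.
move: c1; case: eqP => /=; first by lia.
by rewrite !add0n => _ ? _; apply: IH.
Qed.

Lemma uss_min_le_label_count (y : nat) (s : uss_state) :
  (count_mem (Some y) (map fst s) <= 1)%N -> Some y \in map fst s ->
  (uss_min s <= label_count y s)%N.
Proof.
move=> c1 /mapP[pr prs pry].
by rewrite (label_count_bin c1 prs (esym pry))//; apply: uss_min_le.
Qed.

Lemma uss_min_mul_le (m t : nat) (s : uss_state) :
  uss_inv m t s -> (m * uss_min s <= t)%N.
Proof.
case=> <- _; apply: leq_trans.
suff h n : {in s, forall pr, (n <= pr.2)%N} ->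
    (size s * n <= sumn (map snd s))%N.
  by apply: h => pr; apply: uss_min_le.
elim: s => //= a s IH h; rewrite mulSn leq_add//; first by rewrite h ?mem_head.
by apply: IH => pr prs; apply: h; rewrite inE prs orbT.
Qed.

(** The weight [g] is general so as to serve twice: for the total count, with [b = 1], and for the
    count of a single label [y], with [b = (x == y)]. *)
Lemma sumn_incr (x : nat) (s : uss_state) (g : option nat -> nat -> nat)
  (b : nat) :
  (forall k, g (Some x) k.+1 = g (Some x) k + b)%N ->
  sumn [seq g pr.1 pr.2 | pr <-
    [seq (if pr.1 == Some x then (pr.1, pr.2.+1) else pr) | pr <- s]] =
  (sumn [seq g pr.1 pr.2 | pr <- s] + b * count_mem (Some x) (map fst s))%N.
Proof.
move=> gS; elim: s => [|[l k] s IH] /=; first by rewrite muln0.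
rewrite {}IH; case: eqP => [->|_] /=; last by rewrite add0n addnA.
by rewrite gS; lia.
Qed.

Lemma count_mem1 (x : nat) (s : uss_state) :
  (count_mem (Some x) (map fst s) <= 1)%N -> Some x \in map fst s ->
  count_mem (Some x) (map fst s) = 1%N.
Proof. by rewrite -has_pred1 has_count => *; lia. Qed.

Lemma uss_inv_step (R : realType) (m t : nat) (s : uss_state) (x : nat)
  (u v : R) : (0 < m)%N -> u < 1 -> uss_inv m t s ->
  uss_inv m t.+1 (uss_step s x u v).
Proof.
move=> m0 u1 [sm c1 st]; rewrite uss_stepE; case: ifPn => [xs|xs].
- split; first by rewrite size_map.
  + move=> z; rewrite -map_comp (@eq_map _ _ _ fst)//.
    by move=> pr /=; case: ifP.
  + have := @sumn_incr x s (fun _ k => k) 1 (fun k => esym (addn1 k)).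
    rewrite count_mem1// => h; apply: leq_trans (eq_leq h) _.
    by rewrite muln1 addn1 ltnS.
have [] := @uss_pickP R s u _ u1; first by rewrite sm.
set i := uss_pick s u => im imin; set lbl := if _ then _ else _.
split.
- by rewrite size_set_nth -sm; apply/maxn_idPr.
- move=> z; rewrite map_set_nth count_set_nth_ltn ?size_map//.
  rewrite (nth_map (None, 0%N))//.
  rewrite /= /lbl; case: ifP => _; last by rewrite addnK.
  apply: leq_trans (leq_subr _ _) _.
  case: eqP => [[<-]|_]; last by rewrite addn0.
  by move: xs; rewrite -has_pred1 has_count -leqNgt leqn0 => /eqP->.
- rewrite map_set_nth sumn_set_nth_ltn ?size_map//.
  rewrite (nth_map (None, 0%N))// imin/=; lia.
Qed.

Lemma uss_inv_run (R : realType) (m : nat) (x : nat -> nat) (u v : nat -> R)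
  (t : nat) :
  (0 < m)%N -> (forall s, u s < 1) -> uss_inv m t (uss_run m x u v t).
Proof.
move=> m0 u1; elim: t => [|t IH] /=; last exact: uss_inv_step.
split; rewrite /uss_init ?size_nseq//; last by rewrite map_nseq; elim: (m).
by move=> z; rewrite map_nseq; elim: (m).
Qed.

(** * Effect of one step on the count of a fixed item *)

Lemma label_count_step_in (R : realType) (m t : nat) (s : uss_state)
  (x y : nat) (u v : R) : uss_inv m t s -> Some x \in map fst s ->
  label_count y (uss_step s x u v) = (label_count y s + (x == y))%N.
Proof.
move=> [sm c1 st] xs; rewrite uss_stepE xs /label_count.
have := @sumn_incr x s (fun l k => if l == Some y then k else 0)%N (x == y).
rewrite count_mem1// muln1 => -> // k.
by rewrite (inj_eq Some_inj); case: eqP => _; rewrite ?addn1.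
Qed.

(** Only the chosen bin changes its contribution to the sum. If [y] owns that bin, its count is the
    minimum; if [x = y], its count was 0; the two cases exclude each other because [x] is not a
    label. *)
Lemma label_count_step_out (R : realType) (m t : nat) (s : uss_state)
  (x y : nat) (u v : R) : (0 < m)%N -> u < 1 -> uss_inv m t s ->
  Some x \notin map fst s ->
  let owned := (nth (None, 0%N) s (uss_pick s u)).1 == Some y in
  label_count y (uss_step s x u v) =
  if v < 1 / (uss_min s).+1%:R then
    if x == y then (uss_min s).+1
    else if owned then 0%N else label_count y s
  else if owned then (uss_min s).+1 else label_count y s.
Proof.
move=> m0 u1 [sm c1 st] xs owned; rewrite uss_stepE (negbTE xs).
have [] := @uss_pickP R s u _ u1; first by rewrite sm.
rewrite /owned; set i := uss_pick s u => im imin.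
rewrite {1}/label_count map_set_nth sumn_set_nth_ltn ?size_map//.
rewrite (nth_map (None, 0%N))// -/(label_count y s) imin /=.
have xy : x == y -> label_count y s = 0%N.
  by move=> /eqP xy; rewrite label_count_out// -xy.
have own : (nth (None, 0%N) s i).1 == Some y -> label_count y s = uss_min s.
  by move=> /eqP iy; rewrite (label_count_bin (c1 y) _ iy) ?imin// mem_nth.
have xyF : (nth (None, 0%N) s i).1 == Some y -> x == y = false.
  move=> /eqP iy; apply/eqP => xy'; case/negP: xs; rewrite xy' -iy.
  by apply: map_f; rewrite mem_nth.
case: (v < _); rewrite /= ?(inj_eq Some_inj);
  case: (boolP (_.1 == Some y)) => [iy|_].
- by rewrite xyF// own//= addn0 subnn.
- by rewrite subn0; case: ifP => [/xy ->|_]; rewrite ?add0n ?addn0.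
- by rewrite own// addnC addnK.
- by rewrite addn0 subn0.
Qed.

(** The chosen bin has the smallest count, so it is not the bin of [y], and [y] cannot be
    evicted. *)
Lemma label_count_step_safe (R : realType) (m t : nat) (s : uss_state)
  (x y : nat) (u v : R) : (0 < m)%N -> u < 1 -> uss_inv m t s ->
  (uss_min s < label_count y s)%N ->
  (label_count y s + (x == y) <= label_count y (uss_step s x u v))%N.
Proof.
move=> m0 u1 sinv safe; have [xs|xs] := boolP (Some x \in map fst s).
  by rewrite (label_count_step_in _ _ _ sinv).
rewrite (label_count_step_out _ _ m0 u1 sinv)//=.
have -> : (x == y) = false.
  by apply/eqP => xy; move: safe; rewrite label_count_out// -xy.
case: (boolP (_ == Some y)) => [/eqP iy|_]; last by case: ifP; rewrite addn0.
have [sm c1 _] := sinv.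
have [|im imin] := @uss_pickP R s u _ u1; first by rewrite sm.
move: safe; rewrite (label_count_bin (c1 y) _ iy) ?mem_nth//.
by rewrite imin ltnn.
Qed.

Lemma label_count_step_enter (R : realType) (m t : nat) (s : uss_state)
  (y : nat) (u v : R) : (0 < m)%N -> u < 1 -> uss_inv m t s ->
  Some y \notin map fst s -> v < 1 / (uss_min s).+1%:R ->
  label_count y (uss_step s y u v) = (uss_min s).+1.
Proof.
move=> m0 u1 sinv ys va.
by rewrite (label_count_step_out _ _ m0 u1 sinv)//= va eqxx.
Qed.

(** On [hit] the bin of [y] is chosen for a foreign item: the count gains 1 for certain and forfeits
    [uss_min s + 1] if the coin succeeds. As the coin has probability [1 / (uss_min s + 1)], the two
    corrections cancel in expectation. *)
Lemma label_count_step_risk (R : realType) (m t : nat) (s : uss_state)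
  (x y : nat) (u v : R) : (0 < m)%N -> u < 1 -> uss_inv m t s ->
  Some y \in map fst s -> label_count y s = uss_min s ->
  let hit := (Some x \notin map fst s) &&
             ((nth (None, 0%N) s (uss_pick s u)).1 == Some y) in
  (label_count y s + (x == y) + hit <=
   label_count y (uss_step s x u v)
   + (hit && (v < 1 / (uss_min s).+1%:R)%R) * (uss_min s).+1)%N.
Proof.
move=> m0 u1 sinv ys yN; have [xs|xs] := boolP (Some x \in map fst s).
  by rewrite (label_count_step_in _ _ _ sinv)//=; lia.
rewrite (label_count_step_out _ _ m0 u1 sinv)//=.
have -> : (x == y) = false.
  by apply/eqP => xy; move: xs; rewrite xy ys.
by rewrite yN; case: (v < _); case: (_ == Some y) => /=; lia.
Qed.

(** Limits the upward jump, so that for large [t] the new value of [Y] stays in the range where the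
    potential is affine. *)
Lemma label_count_step_le (R : realType) (m t : nat) (s : uss_state)
  (x y : nat) (u v : R) : (0 < m)%N -> u < 1 -> uss_inv m t s ->
  (label_count y s <= uss_min s)%N ->
  (label_count y (uss_step s x u v) <= (uss_min s).+1)%N.
Proof.
move=> m0 u1 sinv yN; have [xs|xs] := boolP (Some x \in map fst s).
  by rewrite (label_count_step_in _ _ _ sinv)//; lia.
rewrite (label_count_step_out _ _ m0 u1 sinv)//=.
by do ![case: ifP => _]; rewrite ?leqnn ?(leqW yN).
Qed.

(** * The potential and its drift under a Bernoulli increment *)

Definition potential (R : realType) (l y : R) : R :=
  if y <= 0 then expR (l * y) else 1 + l * y.

Lemma potential_pos (R : realType) (l y : R) : 0 < l -> 0 < potential l y.
Proof.
move=> l0; rewrite /potential; case: ifPn; first by rewrite expR_gt0.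
by rewrite -ltNge => y0; rewrite addr_gt0// mulr_gt0.
Qed.

Lemma potential_ge0 (R : realType) (l y : R) :
  0 <= y -> potential l y = 1 + l * y.
Proof.
rewrite le_eqVlt => /predU1P[<-|y0].
  by rewrite /potential lexx mulr0 expR0 addr0.
by rewrite /potential leNgt y0.
Qed.

Lemma potential_le_expR (R : realType) (l y : R) :
  potential l y <= expR (l * y).
Proof. by rewrite /potential; case: ifP => // _; apply: expR_ge1Dx. Qed.

Lemma potential_mono (R : realType) (l y z : R) :
  0 < l -> y <= z -> potential l y <= potential l z.
Proof.
move=> l0 yz; rewrite {2}/potential; case: ifPn => z0.
  apply: le_trans (potential_le_expR _ _) _.
  by rewrite ler_expR ler_pM2l.
rewrite /potential; case: ifPn => y0; last by rewrite lerD2l ler_pM2l.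
apply: (@le_trans _ _ 1).
  by rewrite -expR0 ler_expR pmulr_rle0.
by rewrite lerDl mulr_ge0 ?(ltW l0)// ltW// ltNge.
Qed.

(** From [1 - x <= exp (- x)] one gets [(1 - x) exp x <= 1], while [(1 - x) (1 + x + 2 x^2) = 1 +
    x^2 (1 - 2 x)] is at least 1 for [x <= 1/2]. *)
Lemma expR_le_quadratic (R : realType) (x : R) :
  x <= 1/2 -> expR x <= 1 + x + 2 * x ^+ 2.
Proof.
move=> x2; have := expR_ge1Dx (- x); rewrite expRN => h.
have e0 := expR_gt0 x.
have h1 : (1 - x) * expR x <= 1.
  by rewrite -(ler_pM2r e0) mulVf ?gt_eqF// in h.
have h2 : 0 <= x ^+ 2 * (1 - 2 * x) by rewrite mulr_ge0 ?sqr_ge0//; lra.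
have : (1 - x) * expR x <= (1 - x) * (1 + x + 2 * x ^+ 2) by nra.
by rewrite ler_pM2l//; lra.
Qed.

(** For [y >= 1] both new arguments are nonnegative, so the potential is affine and loses exactly
    [l (p - q)]. For smaller [y], bounding it by the exponential costs a second-order error of at
    most [2 l^2], which the first-order gain [l (p - q)] absorbs because [2 l <= p - q]. *)
Lemma potential_drift (R : realType) (l p q y : R) :
  0 < l -> 0 <= q -> q < p -> p <= 1 -> 2 * l <= p - q ->
  p * potential l (y + q - 1) + (1 - p) * potential l (y + q)
  <= potential l y - (if 1 <= y then l * (p - q) else 0).
Proof.
move=> l0 q0 qp p1 l2.
have [y1|y1] := leP 1 y.
  by rewrite !potential_ge0 ?(le_trans _ y1)//; nra.
rewrite subr0; have [y0|y0] := leP y 0.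
  have -> : potential l y = expR (l * y) by rewrite /potential y0.
  have h z : potential l (y + z) <= expR (l * y) * expR (l * z).
    by rewrite -expRD -mulrDr; apply: potential_le_expR.
  have h1 := h (q - 1); have h2 := h q.
  have g1 : expR (l * (q - 1)) <= 1 + l * (q - 1) + 2 * (l * (q - 1)) ^+ 2.
    by apply: expR_le_quadratic; nra.
  have g2 : expR (l * q) <= 1 + l * q + 2 * (l * q) ^+ 2.
    by apply: expR_le_quadratic; nra.
  have e0 := expR_gt0 (l * y).
  have g : p * expR (l * (q - 1)) + (1 - p) * expR (l * q) <= 1.
    have g3 : (l * (q - 1)) ^+ 2 <= l ^+ 2.
      by rewrite exprMn ler_piMr ?sqr_ge0//; nra.
    have g4 : (l * q) ^+ 2 <= l ^+ 2.
      by rewrite exprMn ler_piMr ?sqr_ge0//; nra.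
    have k1 : p * expR (l * (q - 1)) <= p * (1 + l * (q - 1) + 2 * l ^+ 2).
      by rewrite ler_pM2l; lra.
    have k2 : (1 - p) * expR (l * q) <= (1 - p) * (1 + l * q + 2 * l ^+ 2).
      by apply: ler_wpM2l; lra.
    by nra.
  rewrite -addrA in h1 *.
  have k1 : p * potential l (y + (q - 1))
      <= p * (expR (l * y) * expR (l * (q - 1))).
    by rewrite ler_pM2l; lra.
  have k2 : (1 - p) * potential l (y + q)
      <= (1 - p) * (expR (l * y) * expR (l * q)).
    by apply: ler_wpM2l; lra.
  apply: le_trans (lerD k1 k2) _.
  rewrite [leLHS](_ : _ = expR (l * y) *
    (p * expR (l * (q - 1)) + (1 - p) * expR (l * q))); last by ring.
  by rewrite ler_piMr// ltW.
rewrite (@potential_ge0 _ l (y + q)); last lra.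
rewrite (@potential_ge0 _ l y); last lra.
(* For [0 < y < 1] only the argument [z] can be negative, and then [z > -1], which bounds the
   quadratic error by [2 l^2]. *)
set z := y + q - 1.
have hz : potential l z <= 1 + l * z + 2 * l ^+ 2.
  have [z0|z0] := leP 0 z; first by rewrite potential_ge0// lerDl; nra.
  apply: le_trans (potential_le_expR _ _) _.
  have z1 : z ^+ 2 <= 1 by rewrite /z in z0 *; nra.
  have l12 : l * z <= 1/2 by nra.
  apply: le_trans (expR_le_quadratic l12) _.
  by rewrite lerD2l ler_pM2l// exprMn ler_piMr// sqr_ge0.
have : p * potential l z <= p * (1 + l * z + 2 * l ^+ 2).
  by rewrite ler_pM2l; lra.
by rewrite /z; nra.
Qed.

(** * Measurability of countably-valued functions and of the sketch state *)

Definition discrete_rv (d : measure_display) (T : measurableType d) (K : Type)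
  (Y : T -> K) : Prop := forall B : set K, measurable (Y @^-1` B).

Lemma discrete_rv_cst (d : measure_display) (T : measurableType d) (K : Type)
  (k : K) : discrete_rv (fun _ : T => k).
Proof. by move=> B; rewrite (preimage_cst k B); case: ifP. Qed.

Lemma discrete_rv_comp (d : measure_display) (T : measurableType d)
  (K L : Type) (Y : T -> K) (h : K -> L) :
  discrete_rv Y -> discrete_rv (fun w => h (Y w)).
Proof. by move=> mY B; apply: (mY (h @^-1` B)). Qed.

(** Cut along the countably many values of [Y], enumerated by [unpickle]; on each piece the index of
    [W] is fixed. An update of the sketch is handled by freezing the state, the item and the bin in
    turn. *)
Lemma discrete_rv_bind (d : measure_display) (T : measurableType d)
  (K : countType) (L : Type) (Y : T -> K) (W : K -> T -> L) :
  discrete_rv Y -> (forall k, discrete_rv (W k)) ->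
  discrete_rv (fun w => W (Y w) w).
Proof.
move=> mY mW B.
rewrite (_ : _ @^-1` B = \bigcup_n
    (if unpickle n is Some k then Y @^-1` [set k] `&` W k @^-1` B else set0)).
  apply: bigcupT_measurable => n; case: (unpickle n) => // k.
  by apply: measurableI; [exact: mY|exact: mW].
apply/seteqP; split => [w Bw|w [n _]] /=.
  by exists (pickle (Y w)) => //; rewrite pickleK.
by case: (unpickle n) => // k [/= ->].
Qed.

Lemma discrete_rv_bool (d : measure_display) (T : measurableType d)
  (b : T -> bool) : measurable [set w | b w] -> discrete_rv b.
Proof.
move=> mb B; rewrite -[X in measurable X]setTI.
by apply: (measurable_fun_bool true) => //; rewrite setTI.
Qed.

Lemma measurable_lt_preimage (d : measure_display) (T : measurableType d)
  (R : realType) (U : T -> R) (c : R) :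
  (forall B : set R, measurable B -> measurable (U @^-1` B)) ->
  measurable [set w | U w < c].
Proof.
move=> mU; have := mU `]-oo, c[%classic (measurable_itv _).
by rewrite set_itvNyo.
Qed.

Lemma discrete_rv_uss_pick (d : measure_display) (T : measurableType d)
  (R : realType) (s : uss_state) (U : T -> R) :
  (forall B : set R, measurable B -> measurable (U @^-1` B)) ->
  discrete_rv (fun w => uss_pick s (U w)).
Proof.
move=> mU; rewrite /uss_pick; set idxs := [seq i <- _ | _].
apply: (discrete_rv_comp (nth 0%N idxs)).
elim: (iota _ _) => /= [|j l IH]; first exact: discrete_rv_cst.
apply: (@discrete_rv_bind _ _ _ _ (fun w => U w < j.+1%:R / (size idxs)%:R)
  (fun b w => if b then 0%N
    else (find (fun j : nat => U w < j.+1%:R / (size idxs)%:R) l).+1)).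
  by apply: discrete_rv_bool; apply: measurable_lt_preimage.
case; first exact: discrete_rv_cst.
exact: (discrete_rv_comp (S)).
Qed.

(** Measurability is asked only of the inputs before time [n], so that [T] may also carry the
    sigma-algebra generated by the past. *)
Lemma discrete_rv_uss_run (d : measure_display) (T : measurableType d)
  (R : realType) (m n : nat) (X : nat -> T -> nat) (U V : nat -> T -> R) :
  (forall s, (s < n)%N -> discrete_rv (X s)) ->
  (forall s, (s < n)%N -> forall B, measurable B -> measurable (U s @^-1` B)) ->
  (forall s, (s < n)%N -> forall B, measurable B -> measurable (V s @^-1` B)) ->
  discrete_rv (fun w => uss_run m (X^~ w) (U^~ w) (V^~ w) n).
Proof.
elim: n => [|n IH] mX mU mV /=; first exact: discrete_rv_cst.
apply: (@discrete_rv_bind _ _ uss_state _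
  (fun w => uss_run m (X^~ w) (U^~ w) (V^~ w) n)
  (fun s w => uss_step s (X n w) (U n w) (V n w))).
  by apply: IH => s sn; [apply: mX|apply: mU|apply: mV]; exact: ltnW.
move=> s; apply: (@discrete_rv_bind _ _ nat _ (X n)
  (fun x w => uss_step s x (U n w) (V n w))); first exact: mX.
move=> x; have [xs|xs] := boolP (Some x \in map fst s).
  apply: (eq_ind _ (@discrete_rv _ _ _) (@discrete_rv_cst _ T _
    (map (fun pr => if pr.1 == Some x then (pr.1, pr.2.+1) else pr) s))).
  by apply/funext => w; rewrite uss_stepE xs.
pose next i (b : bool) := set_nth (None, 0%N) s i
  (if b then Some x else (nth (None, 0%N) s i).1, (uss_min s).+1).
apply: (eq_ind (fun w => next (uss_pick s (U n w))
  (V n w < 1 / (uss_min s).+1%:R)) (@discrete_rv _ _ _)); last first.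
  by apply/funext => w; rewrite uss_stepE (negbTE xs).
apply: (@discrete_rv_bind _ _ nat _ (fun w => uss_pick s (U n w))
  (fun i w => next i (V n w < 1 / (uss_min s).+1%:R))).
  by apply: discrete_rv_uss_pick; exact: mU.
move=> i; apply: (discrete_rv_comp (next i)).
by apply: discrete_rv_bool; apply: measurable_lt_preimage; exact: mV.
Qed.

(** * Independence of the current item and coin from the past *)

Lemma independent_g_sigma (d : measure_display) (T : measurableType d)
  (R : realType) (P : probability T R) (G : set (set T)) (H : set T) :
  G `<=` measurable -> setI_closed G -> G setT -> measurable H ->
  (forall E, G E -> P (E `&` H) = (P E * P H)%E) ->
  forall E, <<s G>> E -> P (E `&` H) = (P E * P H)%E.
Proof.
move=> mG IG GT mH GH E GE.
have PH : P H = (fine (P H))%:E by rewrite fineK// fin_num_measure.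
have PH0 : 0 <= fine (P H) by apply: fine_ge0.
(* Restricting [P] to [H] and scaling [P] by [P H] give two finite measures that agree on the
   pi-system [G], hence on the sigma-algebra it generates. *)
have := @g_sigma_algebra_measure_unique _ R T G mG (fun=> setT) (fun=> GT)
  (bigcup_const _ (ex_intro _ 0%N I)) (mrestr P mH) (mscale (NngNum PH0) P) IG.
move=> uniq_ext; rewrite muleC PH; apply: uniq_ext GE => [B GB|k].
  by change (P (B `&` H) = (fine (P H))%:E * P B)%E; rewrite GH// muleC PH.
by rewrite /= /mrestr setTI (le_lt_trans (probability_le1 _ mH))// ltry.
Qed.

Definition block (T : Type) (R : realType) (X : nat -> T -> nat)
  (U V : nat -> T -> R) (n : nat) (A : nat -> set nat) (B C : nat -> set R)
  : set T :=
  \bigcap_(t in [set t | (t < n)%N])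
    (X t @^-1` A t `&` U t @^-1` B t `&` V t @^-1` C t).

(* Rectangles of the steps [0 .. t] that do not constrain [V t], nor, when
   [past] is set, [X t] and [U t]. *)
Definition rects (T : Type) (R : realType) (X : nat -> T -> nat)
  (U V : nat -> T -> R) (past : bool) (t : nat) : set (set T) :=
  [set E | exists A B C,
    [/\ forall s, measurable (B s), forall s, measurable (C s), C t = setT,
        past -> A t = setT /\ B t = setT & E = block X U V t.+1 A B C]].

Lemma rects_setI (T : Type) (R : realType) (X : nat -> T -> nat)
  (U V : nat -> T -> R) (past : bool) (t : nat) :
  setI_closed (rects X U V past t).
Proof.
move=> E E' [A [B [C [mB mC Ct ABt ->]]]] [A' [B' [C' [mB' mC' Ct' ABt' ->]]]].
exists (fun s => A s `&` A' s), (fun s => B s `&` B' s),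
  (fun s => C s `&` C' s); split.
- by move=> s; apply: measurableI.
- by move=> s; apply: measurableI.
- by rewrite Ct Ct' setTI.
- by move=> h; have [-> ->] := ABt h; have [-> ->] := ABt' h; rewrite !setTI.
rewrite /block -bigcapI; apply: eq_bigcapr => s _.
by rewrite !preimage_setI; apply/seteqP; split => w /=; tauto.
Qed.

Lemma rects_setT (T : Type) (R : realType) (X : nat -> T -> nat)
  (U V : nat -> T -> R) (past : bool) (t : nat) : rects X U V past t setT.
Proof.
exists (fun=> setT), (fun=> setT), (fun=> setT); split=> //.
by rewrite /block; apply/esym; rewrite -subTset => w _ s _ /=.
Qed.

Definition upd (S : Type) (A : nat -> set S) (t : nat) (D : set S) :
  nat -> set S := fun s => if s == t then D else A s.

Lemma block_upd (T : Type) (R : realType) (X : nat -> T -> nat)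
  (U V : nat -> T -> R) (n : nat) (t : nat) (A : set nat) (B C : set R)
  (FA : nat -> set nat) (FB FC : nat -> set R) : (t < n)%N ->
  block X U V n FA FB FC `&`
    (X t @^-1` A `&` U t @^-1` B `&` V t @^-1` C) =
  block X U V n (upd FA t (FA t `&` A)) (upd FB t (FB t `&` B))
    (upd FC t (FC t `&` C)).
Proof.
move=> tn; apply/seteqP; split => [w [wb wt] s sn|w wb].
  have := wb s sn; rewrite /upd; case: eqP => [->|//] /=.
  by case: wt => -[]; tauto.
have := wb t tn; rewrite /upd eqxx /= => h.
split; last by tauto.
move=> s sn; have := wb s sn; rewrite /upd; case: eqP => [->|//] /=.
by tauto.
Qed.

Lemma measurable_block (d : measure_display) (T : measurableType d)
  (R : realType) (X : nat -> T -> nat) (U V : nat -> T -> R) n A B C :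
  (forall t (A : set nat), measurable (X t @^-1` A)) ->
  (forall t B, measurable B -> measurable (U t @^-1` B)) ->
  (forall t B, measurable B -> measurable (V t @^-1` B)) ->
  (forall s, measurable (B s)) -> (forall s, measurable (C s)) ->
  measurable (block X U V n A B C).
Proof.
move=> mX mU mV mB mC; rewrite /block bigcap_mkcond.
apply: bigcapT_measurable => s; case: ifP => // _.
by apply: measurableI; [apply: measurableI|]; auto.
Qed.

Lemma measurable_upd (R : realType) (F : nat -> set R) t D :
  (forall s, measurable (F s)) -> measurable D ->
  forall s, measurable (upd F t D s).
Proof. by move=> mF mD s; rewrite /upd; case: ifP. Qed.

Lemma rects_measurable (d : measure_display) (T : measurableType d)
  (R : realType) (X : nat -> T -> nat) (U V : nat -> T -> R) (past : bool) t :
  (forall t (A : set nat), measurable (X t @^-1` A)) ->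
  (forall t B, measurable B -> measurable (U t @^-1` B)) ->
  (forall t B, measurable B -> measurable (V t @^-1` B)) ->
  rects X U V past t `<=` measurable.
Proof.
by move=> mX mU mV E [A [B [C [mB mC _ _ ->]]]]; apply: measurable_block.
Qed.

Lemma rects_coord (T : Type) (R : realType) (X : nat -> T -> nat)
  (U V : nat -> T -> R) (past : bool) t s (A : set nat) (B C : set R) :
  (s <= t)%N -> measurable B -> measurable C -> (s = t -> C = setT) ->
  (s = t -> past -> A = setT /\ B = setT) ->
  rects X U V past t (X s @^-1` A `&` U s @^-1` B `&` V s @^-1` C).
Proof.
move=> st mB mC Ct ABt.
exists (upd (fun=> setT) s A), (upd (fun=> setT) s B), (upd (fun=> setT) s C).
split.
- by apply: measurable_upd.
- by apply: measurable_upd.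
- by rewrite /upd; case: eqP => // /esym/Ct.
- by rewrite /upd; case: eqP => [/esym/ABt h /h|].
have := @block_upd T R X U V t.+1 s A B C
  (fun=> setT) (fun=> setT) (fun=> setT) st.
rewrite !setTI => <-.
rewrite [X in _ = X `&` _](_ : _ = setT) ?setTI//.
by rewrite -subTset => w _ k _ /=.
Qed.

(** The state before step [t] depends only on inputs of earlier steps, which the rectangles leave
    unrestricted for either value of [past]. *)
Lemma discrete_rv_uss_run_rects (T : pointedType) (R : realType)
  (X : nat -> T -> nat) (U V : nat -> T -> R) (past : bool) (t m : nat)
  (B : set uss_state) :
  <<s rects X U V past t>>
    ((fun w => uss_run m (X^~ w) (U^~ w) (V^~ w) t) @^-1` B).
Proof.
have coord s A C D : (s < t)%N -> measurable C -> measurable D ->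
    <<s rects X U V past t>> (X s @^-1` A `&` U s @^-1` C `&` V s @^-1` D).
  move=> st mC mD; apply: sub_sigma_algebra.
  apply: rects_coord => //; [exact: ltnW|move=> e|move=> e];
    by move: st; rewrite e ltnn.
apply: (@discrete_rv_uss_run _ (g_sigma_algebraType (rects X U V past t))
  R m t X U V).
- move=> s st C; have := coord s C setT setT st measurableT measurableT.
  by rewrite !preimage_setT !setIT.
- move=> s st C mC; have := coord s setT C setT st mC measurableT.
  by rewrite !preimage_setT setIT setTI.
- move=> s st C mC; have := coord s setT setT C st measurableT mC.
  by rewrite !preimage_setT setIT setTI.
Qed.

(** Intersecting a rectangle that is free at time [t] with an event on [X t] gives a block again;
    the product rule applied to both blocks differs only in the factor of [X t]. *)
Lemma independent_item (d : measure_display) (T : measurableType d)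
  (R : realType) (P : probability T R) (X : nat -> T -> nat)
  (U V : nat -> T -> R) (t : nat) (D : set nat) :
  (forall t (A : set nat), measurable (X t @^-1` A)) ->
  (forall t B, measurable B -> measurable (U t @^-1` B)) ->
  (forall t B, measurable B -> measurable (V t @^-1` B)) ->
  stream_indep P X U V ->
  forall E, <<s rects X U V true t>> E ->
  P (E `&` X t @^-1` D) = (P E * P (X t @^-1` D))%E.
Proof.
move=> mX mU mV ind; apply: independent_g_sigma => //.
- exact: rects_measurable.
- exact: rects_setI.
- exact: rects_setT.
move=> E [A [B [C [mB mC Ct /(_ isT)[At Bt] ->]]]].
have -> : X t @^-1` D =
    X t @^-1` D `&` U t @^-1` setT `&` V t @^-1` setT.
  by rewrite !preimage_setT !setIT.
rewrite block_upd// /block.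
have mB' : forall s, measurable (upd B t (B t `&` setT) s).
  by apply: measurable_upd; rewrite ?setIT.
have mC' : forall s, measurable (upd C t (C t `&` setT) s).
  by apply: measurable_upd; rewrite ?setIT.
rewrite !ind//.
rewrite !big_ord_recr/= At Bt Ct /upd eqxx !preimage_setT !setIT !setTI.
rewrite !probability_setT !mule1; congr (_ * _)%E.
by apply: eq_bigr => i _; rewrite ltn_eqF.
Qed.

(** Here the past is enlarged by [X t] and [U t]: whether the bin of [y] is hit depends on both, and
    the coin must be independent of that event. *)
Lemma independent_coin (d : measure_display) (T : measurableType d)
  (R : realType) (P : probability T R) (X : nat -> T -> nat)
  (U V : nat -> T -> R) (t : nat) (D : set R) : measurable D ->
  (forall t (A : set nat), measurable (X t @^-1` A)) ->
  (forall t B, measurable B -> measurable (U t @^-1` B)) ->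
  (forall t B, measurable B -> measurable (V t @^-1` B)) ->
  stream_indep P X U V ->
  forall E, <<s rects X U V false t>> E ->
  P (E `&` V t @^-1` D) = (P E * P (V t @^-1` D))%E.
Proof.
move=> mD mX mU mV ind; apply: independent_g_sigma => //; last 2 first.
- exact: mV.
- move=> E [A [B [C [mB mC Ct _ ->]]]].
  have -> : V t @^-1` D =
      X t @^-1` setT `&` U t @^-1` setT `&` V t @^-1` D.
    by rewrite !preimage_setT !setTI.
  rewrite block_upd// /block.
  have mB' : forall s, measurable (upd B t (B t `&` setT) s).
    by apply: measurable_upd; rewrite ?setIT.
  have mC' : forall s, measurable (upd C t (C t `&` D) s).
    by apply: measurable_upd; rewrite ?Ct ?setTI.
  rewrite !ind//.
  rewrite !big_ord_recr/= Ct /upd eqxx !preimage_setT !setIT !setTI.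
  rewrite !probability_setT !mule1 -[RHS]muleA; congr (_ * _)%E.
  by apply: eq_bigr => i _; rewrite ltn_eqF.
- exact: rects_measurable.
- exact: rects_setI.
- exact: rects_setT.
Qed.

(** * Integral comparison on fibres, and a Borel-Cantelli criterion *)

Lemma ge0_le_integral_fibers (d : measure_display) (T : measurableType d)
  (R : realType) (mu : {measure set T -> \bar R}) (K : countType) (Y : T -> K)
  (g h : T -> \bar R) : discrete_rv Y ->
  (forall w, 0 <= g w)%E -> (forall w, 0 <= h w)%E ->
  measurable_fun [set: T] g -> measurable_fun [set: T] h ->
  (forall w, \int[mu]_(z in Y @^-1` [set Y w]) g z
             <= \int[mu]_(z in Y @^-1` [set Y w]) h z)%E ->
  (\int[mu]_z g z <= \int[mu]_z h z)%E.
Proof.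
move=> mY g0 h0 mg mh gh.
(* The fibres of [Y], numbered by [pickle], form a countable partition; comparing the integrals
   piece by piece plays the part of conditioning on [Y]. *)
pose F n := (fun w => pickle (Y w)) @^-1` [set n].
have mF n : measurable (F n).
  by apply: (discrete_rv_comp (@pickle K) mY).
have UF : \bigcup_n F n = setT.
  by rewrite -subTset => w _; exists (pickle (Y w)).
have tF : trivIset setT F.
  apply/trivIsetP => i j _ _ /eqP ij; rewrite -subset0 => w [Fi Fj].
  by apply: ij; rewrite -Fi -Fj.
rewrite -UF !ge0_integral_bigcup ?UF//.
apply: lee_nneseries => [i _ _|i _]; first exact: integral_ge0.
have [->|/set0P[w Fw]] := eqVneq (F i) set0; first by rewrite !integral_set0.
suff -> : F i = Y @^-1` [set Y w] by [].
rewrite /F -Fw; apply/seteqP; split => z /=; last by move->.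
exact: (pcan_inj (@pickleK K)).
Qed.

(** The negative corrections [b1], [b2] stand on the left of the pointwise bound so that every
    integrand is nonnegative and additivity applies without any integrability condition. *)
Lemma integral_le_indic (d : measure_display) (T : measurableType d)
  (R : realType) (mu : {measure set T -> \bar R}) (A E1 E2 F : set T)
  (g : T -> R) (b1 b2 c1 c2 a e1 e2 f : R) :
  measurable A -> measurable E1 -> measurable E2 -> measurable F ->
  measurable_fun [set: T] g -> (forall w, 0 <= g w) ->
  0 <= b1 -> 0 <= b2 -> 0 <= c1 -> 0 <= c2 ->
  (forall w, A w -> g w + b1 * \1_E1 w + b2 * \1_E2 w <= c1 + c2 * \1_F w) ->
  mu A = a%:E -> mu (A `&` E1) = e1%:E -> mu (A `&` E2) = e2%:E ->
  mu (A `&` F) = f%:E ->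
  (\int[mu]_(w in A) (g w)%:E <= (c1 * a + c2 * f - b1 * e1 - b2 * e2)%:E)%E.
Proof.
move=> mA mE1 mE2 mF mg g0 b10 b20 c10 c20 le_g muA muE1 muE2 muF.
have scaled c (E : set T) e : 0 <= c -> measurable E -> mu (A `&` E) = e%:E ->
    [/\ measurable_fun A (fun w => (c * \1_E w)%:E),
        forall w, A w -> (0 <= (c * \1_E w)%:E)%E &
        (\int[mu]_(w in A) (c * \1_E w)%:E)%E = (c * e)%:E].
  move=> c0 mE muE.
  have mI : measurable_fun A (fun w => (\1_E w : R)%:E).
    by apply/measurable_EFinP; apply: measurable_funTS; exact: measurable_indic.
  split.
  - apply/measurable_EFinP; apply: measurable_funM; first exact: measurable_cst.
    by apply: measurable_funTS; exact: measurable_indic.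
  - by move=> w _; rewrite lee_fin mulr_ge0.
  under eq_integral do rewrite EFinM.
  have I0 w : A w -> (0 <= (\1_E w : R)%:E)%E by rewrite lee_fin.
  by rewrite (ge0_integralZl_EFin _ mA I0)// integral_indic// setIC muE.
have [m1 p1 i1] := scaled b1 E1 e1 b10 mE1 muE1.
have [m2 p2 i2] := scaled b2 E2 e2 b20 mE2 muE2.
have [m3 p3 i3] := scaled c2 F f c20 mF muF.
have mgA : measurable_fun A (fun w => (g w)%:E).
  by apply/measurable_EFinP; exact: measurable_funTS.
have : (\int[mu]_(w in A) ((g w)%:E + (b1 * \1_E1 w)%:E + (b2 * \1_E2 w)%:E)
   <= \int[mu]_(w in A) (c1%:E + (c2 * \1_F w)%:E))%E.
  apply: ge0_le_integral => [//|w Aw||//|w Aw]; last by rewrite lee_fin le_g.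
    by rewrite !adde_ge0 ?p1 ?p2// lee_fin.
  by do !apply: emeasurable_funD.
  exact: emeasurable_funD.
have g0A w : A w -> (0 <= (g w)%:E)%E by rewrite lee_fin.
have g1A w : A w -> (0 <= (g w)%:E + (b1 * \1_E1 w)%:E)%E.
  by move=> Aw; rewrite adde_ge0 ?p1 ?g0A.
have c1A w : A w -> (0 <= c1%:E)%E by rewrite lee_fin.
have /= -> := ge0_integralD mu mA g1A (emeasurable_funD mgA m1) p2 m2.
have /= -> := ge0_integralD mu mA g0A mgA p1 m1.
have /= -> := ge0_integralD mu mA c1A (measurable_cst _) p3 m3.
rewrite integral_cst// i1 i2 i3 muA.
have : (0 <= \int[mu]_(w in A) (g w)%:E)%E.
  by apply: integral_ge0 => w _; rewrite lee_fin.
(* The integral is finite, being nonnegative and dominated by a finite quantity, so the corrections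
   can now be subtracted. *)
case: (\int[mu]_(w in A) (g w)%:E)%E => [r| |] //=.
by rewrite -!EFinM -!EFinD !lee_fin; lra.
Qed.

(** Telescoping bounds [c] times the sum of the [mu (B n)] by the finite [Phi 0]; Borel-Cantelli
    concludes. *)
Lemma lim_sup_set_supermartingale (d : measure_display) (T : measurableType d)
  (R : realType) (mu : {measure set T -> \bar R}) (Phi : nat -> \bar R) (c : R)
  (B : nat -> set T) : 0 < c -> (forall n, 0 <= Phi n)%E ->
  (Phi 0%N < +oo)%E -> (forall n, measurable (B n)) ->
  (forall n, Phi n.+1 + c%:E * mu (B n) <= Phi n)%E ->
  mu (lim_sup_set B) = 0%E.
Proof.
move=> c0 Phi0 Phioo mB dec; apply: lim_sup_set_cvg0 => //.
have bound n : (Phi n + \sum_(0 <= i < n) (c%:E * mu (B i)) <= Phi 0%N)%E.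
  elim: n => [|n IH]; first by rewrite big_geq// adde0.
  rewrite big_nat_recr//= [X in (_ + X)%E]addeC addeA.
  by apply: le_trans IH; apply: leeD.
have : (c%:E * \sum_(0 <= i <oo) mu (B i) <= Phi 0%N)%E.
  rewrite -nneseriesZl//; apply: lime_le.
    by apply: is_cvg_nneseries => i _ _; rewrite mule_ge0// lee_fin ltW.
  apply: nearW => n; apply: le_trans (bound n); rewrite leeDr//.
move=> /le_lt_trans/(_ Phioo); case: (\sum_(0 <= i <oo) _)%E => [r| |]//=.
  by move=> _; exact: ltry.
by rewrite gt0_muley ?lte_fin.
Qed.

(** * Drift of the potential on the event of a given current state *)

Lemma indic_bool (T : Type) (R : realType) (b : T -> bool) (w : T) :
  \1_[set z | b z] w = (b w)%:R :> R.
Proof.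
by rewrite indicE; congr (nat_of_bool _)%:R; apply/idP/idP; rewrite inE.
Qed.

Lemma rects_item_pick (T : pointedType) (R : realType) (X : nat -> T -> nat)
  (U V : nat -> T -> R) (t m : nat) (s : uss_state) (B : set uss_state)
  (h : nat -> nat -> bool) :
  <<s rects X U V false t>>
    ((fun w => uss_run m (X^~ w) (U^~ w) (V^~ w) t) @^-1` B `&`
     [set w | h (X t w) (uss_pick s (U t w))]).
Proof.
pose sT := g_sigma_algebraType (rects X U V false t).
have mU C : measurable C -> <<s rects X U V false t>> (U t @^-1` C).
  move=> mC; have := @rects_coord T R X U V false t t setT C setT.
  rewrite !preimage_setT setIT setTI => h'.
  by apply: sub_sigma_algebra; apply: h'.
have mX : @discrete_rv _ sT _ (X t).
  move=> C; have := @rects_coord T R X U V false t t C setT setT.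
  rewrite !preimage_setT !setIT => h'.
  by apply: sub_sigma_algebra; apply: h'.
apply: (@measurableI _ sT); first exact: discrete_rv_uss_run_rects.
have : @discrete_rv _ sT _ (fun w => h (X t w) (uss_pick s (U t w))).
  apply: (@discrete_rv_bind _ sT nat _ (X t)
    (fun x w => h x (uss_pick s (U t w)))) => // x.
  exact: (discrete_rv_comp (h x) (@discrete_rv_uss_pick _ sT R s _ mU)).
exact.
Qed.

Lemma set_andb (T : Type) (b c : T -> bool) :
  [set w | b w] `&` [set w | c w] = [set w | b w && c w].
Proof. by apply/seteqP; split => w /=; [case=> -> -> | move/andP]. Qed.

(** The process [Y t] of the overview, as a function of the state. *)
Definition lag (R : realType) (q : R) (y t : nat) (s : uss_state) : R :=
  q * t%:R - (label_count y s)%:R.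

(** The count grows by at least the Bernoulli variable [X = y], so by monotonicity the new potential
    is at most that of the Bernoulli walk, to which [potential_drift] applies. *)
Lemma integral_atom_safe (d : measure_display) (T : measurableType d)
  (R : realType) (P : probability T R) (m y t : nat) (p q l a : R)
  (s : uss_state) (A : set T) (X : T -> nat) (U V : T -> R) (g : T -> R) :
  (0 < m)%N -> uss_inv m t s -> (uss_min s < label_count y s)%N ->
  (forall w, U w < 1) -> measurable A -> measurable [set w | X w == y] ->
  0 < l -> 0 <= q -> q < p -> p <= 1 -> 2 * l <= p - q -> 0 <= a ->
  P A = a%:E -> P (A `&` [set w | X w == y]) = (a * p)%:E ->
  measurable_fun [set: T] g -> (forall w, 0 <= g w) ->
  (forall w, A w -> g w =
    potential l (lag q y t.+1 (uss_step s (X w) (U w) (V w)))) ->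
  (\int[P]_(w in A) (g w)%:E <=
   ((potential l (lag q y t s)
     - if (1 <= lag q y t s)%R then l * (p - q) else 0) * a)%:E)%E.
Proof.
move=> m0 sinv safe U1 mA mX l0 q0 qp p1 lpq a0 PA PAX mg g0 gA.
set z := lag q y t s.
have pot_mono : potential l (z + q - 1) <= potential l (z + q).
  by apply: potential_mono => //; lra.
have P0 : P (A `&` set0) = 0%E by rewrite setI0 measure0.
have := @integral_le_indic _ _ R P A [set w | X w == y] set0 set0 g
  (potential l (z + q) - potential l (z + q - 1)) 0 (potential l (z + q)) 0
  a (a * p) 0 0 mA mX measurable0 measurable0 mg g0.
move=> /(_ _ _ _ _ _ PA PAX P0 P0) h.
apply: le_trans (h _ _ _ _ _) _ => //.
- by rewrite subr_ge0.
- exact/ltW/potential_pos.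
- move=> w Aw; rewrite indic_bool !mul0r !addr0 gA//.
  have := label_count_step_safe (X w) (V w) m0 (U1 w) sinv safe.
  rewrite -(ler_nat R) natrD => le_count.
  have := @potential_mono R l (lag q y t.+1 (uss_step s (X w) (U w) (V w)))
    (z + q - (X w == y)%:R) l0.
  have -> : lag q y t.+1 (uss_step s (X w) (U w) (V w))
      <= z + q - (X w == y)%:R.
    by rewrite /z /lag -natr1; lra.
  move=> /(_ isT); case: (X w == y); rewrite ?mulr1 ?mulr0 ?subr0; lra.
- have := potential_drift z l0 q0 qp p1 lpq; rewrite lee_fin.
  move=> /(ler_wpM2r a0); lra.
Qed.

(* Below the threshold the potential is affine, and the expected count of [y]
   grows by at least [p] whether or not [y] is a label: replacing a label of
   count [n] by the new item of count [n + 1] with probability [1 / (n + 1)] is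
   unbiased. *)
Lemma integral_atom_risk (d : measure_display) (T : measurableType d)
  (R : realType) (P : probability T R) (m y t : nat) (p q l a e : R)
  (s : uss_state) (A : set T) (X : T -> nat) (U V : T -> R) (g : T -> R) :
  let coin := [set w | V w < 1 / (uss_min s).+1%:R] in
  let hit := [set w | (Some (X w) \notin map fst s) &&
    ((nth (None, 0%N) s (uss_pick s (U w))).1 == Some y)] in
  (0 < m)%N -> uss_inv m t s -> (label_count y s <= uss_min s)%N ->
  (forall w, U w < 1) -> measurable A -> measurable [set w | X w == y] ->
  measurable hit -> measurable coin ->
  0 < l -> 0 <= q -> q < p -> 1 <= (q - 1 / m%:R) * t%:R -> 0 <= a ->
  P A = a%:E -> P (A `&` [set w | X w == y]) = (a * p)%:E ->
  P (A `&` hit) = e%:E ->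
  P (A `&` [set w | X w == y] `&` coin) = (a * p / (uss_min s).+1%:R)%:E ->
  P (A `&` hit `&` coin) = (e / (uss_min s).+1%:R)%:E ->
  measurable_fun [set: T] g -> (forall w, 0 <= g w) ->
  (forall w, A w -> g w =
    potential l (lag q y t.+1 (uss_step s (X w) (U w) (V w)))) ->
  (\int[P]_(w in A) (g w)%:E <=
   ((potential l (lag q y t s)
     - if (1 <= lag q y t s)%R then l * (p - q) else 0) * a)%:E)%E.
Proof.
move=> coin hit m0 sinv risk U1 mA mX mhit mcoin l0 q0 qp tlarge a0
  PA PAX Phit PXc Phc mg g0 gA.
set z := lag q y t s; pose n := uss_min s.
have nm : n%:R <= 1 / m%:R * t%:R :> R.
  rewrite mulrAC mul1r ler_pdivlMr ?ltr0n// mulrC -natrM ler_nat.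
  exact: uss_min_mul_le sinv.
have n1 : 0 < n.+1%:R :> R by rewrite ltr0n.
(* The minimum is at most [t/m], and the threshold on [t] leaves a margin of 1. The count may thus
   rise to [n + 1] with the lag still nonnegative after the step. *)
have zn : 1 <= q * t%:R - n%:R by lra.
have z1 : 1 <= z.
  by apply: le_trans zn _; rewrite /z /lag lerD2l lerN2 ler_nat.
have gE w : A w -> g w = 1 + l * (z + q) - l *
    ((label_count y (uss_step s (X w) (U w) (V w)))%:R - (label_count y s)%:R).
  move=> Aw; rewrite gA// potential_ge0.
    by rewrite /z /lag -natr1; lra.
  have := label_count_step_le (X w) (V w) m0 (U1 w) sinv risk.
  rewrite -/n -(ler_nat R) -natr1 => le_n.
  by rewrite /lag -natr1; lra.
have P0 : P (A `&` set0) = 0%E by rewrite setI0 measure0.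
have c10 : 0 <= 1 + l * (z + q) by nra.
rewrite z1 (@potential_ge0 _ l z); last lra.
(* If [y] is a label, its count is exactly [n] and the contributions of [hit] cancel. If not, it
   enters with count [n + 1] with probability [p / (n + 1)]. The mean gain used is [p] in both
   cases. *)
have [ys|ys] := boolP (Some y \in map fst s).
  have yn : label_count y s = n.
    apply/eqP; rewrite eqn_leq risk/= uss_min_le_label_count//.
    by case: sinv.
  have mF : measurable (hit `&` coin) by apply: measurableI.
  have PF : P (A `&` (hit `&` coin)) = (e / n.+1%:R)%:E by rewrite setIA.
  have := @integral_le_indic _ _ R P A [set w | X w == y] hit (hit `&` coin) g
    l l (1 + l * (z + q)) (l * n.+1%:R) a (a * p) e (e / n.+1%:R)
    mA mX mhit mF mg g0.
  move=> /(_ _ _ _ _ _ PA PAX Phit PF) h.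
  apply: le_trans (h _ _ _ _ _) _ => //; try exact: ltW; first by nra.
    move=> w Aw; rewrite gE// set_andb !indic_bool.
    have := @label_count_step_risk R m t s (X w) y (U w) (V w)
      m0 (U1 w) sinv ys yn.
    rewrite /= -(ler_nat R) !natrD natrM => /(ler_wpM2l (ltW l0)); lra.
  rewrite lee_fin le_eqVlt; apply/orP; left; apply/eqP; field.
  by rewrite nat1r gt_eqF.
have PF : P (A `&` ([set w | X w == y] `&` coin)) = (a * p / n.+1%:R)%:E.
  by rewrite setIA.
have mF : measurable ([set w | X w == y] `&` coin) by apply: measurableI.
have := @integral_le_indic _ _ R P A ([set w | X w == y] `&` coin) set0 set0 g
  (l * n.+1%:R) 0 (1 + l * (z + q)) 0 a (a * p / n.+1%:R) 0 0
  mA mF measurable0 measurable0 mg g0.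
move=> /(_ _ _ _ _ _ PA PF P0 P0) h.
apply: le_trans (h _ _ _ _ _) _ => //; first by nra.
  move=> w Aw; rewrite gE// set_andb indic_bool !mul0r !addr0.
  rewrite (label_count_out ys) subr0.
  have [/andP[/eqP -> Vn]|_] := boolP (_ && _); last first.
    by rewrite mulr0 addr0 gerBl mulr_ge0// ltW.
  by rewrite (label_count_step_enter m0 (U1 w) sinv ys Vn) mulr1 subrK.
rewrite lee_fin le_eqVlt; apply/orP; left; apply/eqP; field.
by rewrite nat1r gt_eqF.
Qed.

(** * Supermartingale property and almost sure conclusion *)

Definition uss_path (T : Type) (R : realType) (m : nat) (X : nat -> T -> nat)
  (U V : nat -> T -> R) (n : nat) (w : T) : uss_state :=
  uss_run m (X^~ w) (U^~ w) (V^~ w) n.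

(** The comparison is made on each fibre of the state at time [t]. Independence supplies the item
    and coin probabilities there, and the fibre falls under the safe or the risky case according to
    the count of [y]. *)
Lemma potential_supermartingale (d : measure_display) (T : measurableType d)
  (R : realType) (P : probability T R) (m y t : nat) (p q l : R)
  (X : nat -> T -> nat) (U V : nat -> T -> R) :
  (0 < m)%N ->
  (forall t (A : set nat), measurable (X t @^-1` A)) ->
  (forall t B, measurable B -> measurable (U t @^-1` B)) ->
  (forall t B, measurable B -> measurable (V t @^-1` B)) ->
  (forall t w, U t w < 1) ->
  (forall a : R, 0 <= a <= 1 -> P (V t @^-1` [set v | v < a]) = a%:E) ->
  P (X t @^-1` [set y]) = p%:E ->
  stream_indep P X U V ->
  0 < l -> 0 <= q -> q < p -> 2 * l <= p - q ->
  1 <= (q - 1 / m%:R) * t%:R ->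
  (\int[P]_w (potential l (lag q y t.+1 (uss_path m X U V t.+1 w)))%:E
   + (l * (p - q))%:E * P [set w | (1 <= lag q y t (uss_path m X U V t w))%R]
   <= \int[P]_w (potential l (lag q y t (uss_path m X U V t w)))%:E)%E.
Proof.
move=> m0 mX mU mV U1 coinP itemP ind l0 q0 qp lpq tlarge.
set S := uss_path m X U V.
have mS n : discrete_rv (S n).
  by apply: discrete_rv_uss_run => s _; [exact: mX|exact: mU|exact: mV].
have mpot n : measurable_fun [set: T]
    (fun w => potential l (lag q y n (S n w))).
  by move=> _ B _; rewrite setTI;
    exact: (discrete_rv_comp (fun s => potential l (lag q y n s)) (mS n)).
have pot0 n w : 0 <= potential l (lag q y n (S n w)).
  exact/ltW/potential_pos.
have p1 : p <= 1.
  by rewrite -lee_fin -itemP; apply: probability_le1; exact: mX.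
set B := [set w | 1 <= lag q y t (S t w)].
have mB : measurable B by exact: (mS t [set s | 1 <= lag q y t s]).
pose c := l * (p - q).
have c0 : 0 <= c by rewrite mulr_ge0 ?subr_ge0 ?ltW.
have mI : measurable_fun [set: T] (fun w => (\1_B w : R)%:E).
  by apply/measurable_EFinP; exact: measurable_indic.
have I0 w : [set: T] w -> (0 <= (\1_B w : R)%:E)%E by rewrite lee_fin.
have mpotE n : measurable_fun [set: T]
    (fun w => (potential l (lag q y n (S n w)))%:E).
  exact/measurable_EFinP.
have mcI : measurable_fun [set: T] (fun w => c%:E * (\1_B w : R)%:E)%E.
  by apply: emeasurable_funM => //; exact: measurable_cst.
(* The probability term becomes the integral of an indicator, so that both sides are integrals and
   can be compared on fibres. *)
rewrite -[X in (_ + _ * P X)%E]setIT -(integral_indic P measurableT mB).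
rewrite -(ge0_integralZl_EFin _ measurableT I0 mI c0).
rewrite -ge0_integralD//; last 2 first.
- by move=> w _; rewrite lee_fin.
- by move=> w _; rewrite mule_ge0// lee_fin.
apply: (ge0_le_integral_fibers (mS t) _ _ (emeasurable_funD (mpotE _) mcI)
  (mpotE t)) => [w|w|].
- by rewrite adde_ge0// ?mule_ge0// lee_fin.
- by rewrite lee_fin.
move=> w0; set s := S t w0; set A := _ @^-1` _.
have mA : measurable A by apply: mS.
have sinv : uss_inv m t s by apply: uss_inv_run.
pose a := fine (P A).
have PA : P A = a%:E by rewrite /a fineK// fin_num_measure.
have a0 : 0 <= a by apply: fine_ge0.
have AS w : A w -> S t w = s by [].
have int_cst (f : T -> \bar R) r : (forall w, A w -> f w = r%:E) ->
    (\int[P]_(w in A) f w)%E = (r * a)%:E.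
  move=> fr; rewrite (eq_integral (cst r%:E)) => [|w /set_mem]; last exact: fr.
  by rewrite integral_cst// EFinM; congr (_ * _)%E; exact: PA.
rewrite (int_cst (fun w => (potential l (lag q y t (S t w)))%:E)
  (potential l (lag q y t s))); last by move=> w /AS ->.
have Epick (h : nat -> nat -> bool) : <<s rects X U V false t>>
    (A `&` [set w | h (X t w) (uss_pick s (U t w))]).
  exact: rects_item_pick.
have subA : <<s rects X U V false t>> `<=` measurable.
  apply: smallest_sub; first exact: sigma_algebra_measurable.
  exact: rects_measurable.
have itemE : X t @^-1` [set y] = [set w | X t w == y].
  by apply/seteqP; split => w /= /eqP.
have mXy : measurable [set w | X t w == y] by rewrite -itemE.
have PAX : P (A `&` [set w | X t w == y]) = (a * p)%:E.
  rewrite -itemE (independent_item _ mX mU mV ind) ?itemP ?PA//.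
  exact: discrete_rv_uss_run_rects.
have n1 : 0 <= (1 : R) / (uss_min s).+1%:R <= 1.
  by rewrite divr_ge0//= ler_pdivrMr// mul1r ler1n.
have coinE E e : <<s rects X U V false t>> E -> P E = e%:E ->
    P (E `&` [set w | V t w < 1 / (uss_min s).+1%:R]) =
    (e / (uss_min s).+1%:R)%:E.
  move=> EG PE; have mlt := measurable_itv `]-oo, (1 / (uss_min s).+1%:R : R)[.
  rewrite set_itvNyo in mlt.
  rewrite (independent_coin mlt mX mU mV ind EG) PE.
  by rewrite coinP// -EFinM mul1r.
have gA w : A w -> potential l (lag q y t.+1 (S t.+1 w)) =
    potential l (lag q y t.+1 (uss_step s (X t w) (U t w) (V t w))).
  by move=> /AS Aw; rewrite -Aw.
have drift : (\int[P]_(w in A) (potential l (lag q y t.+1 (S t.+1 w)))%:E <=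
   ((potential l (lag q y t s)
     - if (1 <= lag q y t s)%R then c else 0) * a)%:E)%E.
  have [risk|safe] := leqP (label_count y s) (uss_min s).
    set hit := fun w => (Some (X t w) \notin map fst s) &&
      ((nth (None, 0%N) s (uss_pick s (U t w))).1 == Some y).
    have hitA : <<s rects X U V false t>> (A `&` [set w | hit w]).
      exact: (Epick (fun x i => (Some x \notin map fst s) &&
        ((nth (None, 0%N) s i).1 == Some y))).
    have mhit : measurable [set w | hit w].
      apply: subA; have := @rects_item_pick T R X U V t m s setT
        (fun x i => (Some x \notin map fst s) &&
          ((nth (None, 0%N) s i).1 == Some y)).
      by rewrite preimage_setT setTI.
    apply: (@integral_atom_risk _ _ _ P m y t p q l a
      (fine (P (A `&` [set w | hit w])))
      s A (X t) (U t) (V t)) => //.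
    + by apply: measurable_lt_preimage; apply: mV.
    + by rewrite fineK// fin_num_measure//; apply: measurableI.
    + by apply: coinE => //; exact: (Epick (fun x _ => x == y)).
    + apply: coinE => //; rewrite fineK// fin_num_measure//.
      exact: measurableI.
  by apply: (@integral_atom_safe _ _ _ P m y t p q l a s A (X t) (U t) (V t)).
have mAf (f : T -> \bar R) : measurable_fun [set: T] f -> measurable_fun A f.
  exact: measurable_funTS.
rewrite ge0_integralD//; [|by move=> w _; rewrite lee_fin|exact: mAf|
  by move=> w _; rewrite mule_ge0// lee_fin|exact: mAf].
rewrite (int_cst (fun w => c%:E * (\1_B w)%:E)%E
  (c * (1 <= lag q y t s)%R%:R)); last first.
  by move=> w /AS Aw; rewrite indic_bool Aw -EFinM.
apply: le_trans (leeD drift (lexx _)) _; rewrite -EFinD lee_fin.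
by case: (1 <= lag q y t s); rewrite ?mulr1 ?mulr0; lra.
Qed.

Lemma ae_eventually_label (d : measure_display) (T : measurableType d)
  (R : realType) (P : probability T R) (m y : nat) (p : R)
  (X : nat -> T -> nat) (U V : nat -> T -> R) :
  (0 < m)%N ->
  (forall t (A : set nat), measurable (X t @^-1` A)) ->
  (forall t B, measurable B -> measurable (U t @^-1` B)) ->
  (forall t B, measurable B -> measurable (V t @^-1` B)) ->
  (forall t w, U t w < 1) ->
  (forall t (a : R), 0 <= a <= 1 -> P (V t @^-1` [set v | v < a]) = a%:E) ->
  (forall t, P (X t @^-1` [set y]) = p%:E) ->
  stream_indep P X U V ->
  1 / m%:R < p ->
  {ae P, forall w, exists t0 : nat, forall t : nat, (t0 <= t)%N ->
    Some y \in map fst (uss_path m X U V t w)}.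
Proof.
move=> m0 mX mU mV U1 coinP itemP ind mp.
have im0 : 0 < 1 / m%:R :> R by rewrite divr_gt0// ltr0n.
(* [q] is the midpoint of [1/m] and [p], and [l] is the largest value with [2 l <= p - q]. *)
pose q := (1 / m%:R + p) / 2; pose l := (p - q) / 2.
have qm : 0 < q - 1 / m%:R by rewrite /q; lra.
have qp : q < p by rewrite /q; lra.
have q0 : 0 < q by lra.
have l0 : 0 < l by rewrite /l; lra.
have lpq : 2 * l <= p - q by rewrite /l; lra.
have [t0 large] : exists t0, forall t, (t0 <= t)%N ->
    1 <= (q - 1 / m%:R) * t%:R.
  exists (Num.bound (1 / (q - 1 / m%:R))) => t tt0.
  rewrite mulrC -ler_pdivrMr//.
  apply: le_trans (ltW (archi_boundP _)) _; first by rewrite divr_ge0// ltW.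
  by rewrite ler_nat.
pose S := uss_path m X U V.
have mS n : discrete_rv (S n).
  by apply: discrete_rv_uss_run => s _; [exact: mX|exact: mU|exact: mV].
pose Phi n :=
  (\int[P]_w (potential l (lag q y (t0 + n) (S (t0 + n)%N w)))%:E)%E.
pose B n := [set w | 1 <= lag q y (t0 + n) (S (t0 + n)%N w)].
have mB n : measurable (B n).
  exact: (mS _ [set s | 1 <= lag q y (t0 + n) s]).
have limsup0 : P (lim_sup_set B) = 0%E.
  apply: (@lim_sup_set_supermartingale _ _ _ P Phi (l * (p - q))) => //.
  - by rewrite mulr_gt0// subr_gt0.
  - move=> n; apply: integral_ge0 => w _.
    by rewrite lee_fin ltW// potential_pos.
  (* At time [t0] the lag is at most [q t0], so the potential is bounded and its integral finite. *)
  - apply: (@le_lt_trans _ _ (\int[P]_w (cst (1 + l * (q * t0%:R))%:E w))%E).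
      apply: ge0_le_integral => //.
      + by move=> w _; rewrite lee_fin ltW// potential_pos.
      + apply/measurable_EFinP => _ C _; rewrite setTI.
        exact: (discrete_rv_comp
          (fun s => potential l (lag q y (t0 + 0) s)) (mS _)).
      + move=> w _; rewrite lee_fin /= -potential_ge0; last first.
          by rewrite mulr_ge0 ?ler0n// ltW.
        apply: potential_mono => //.
        by rewrite /lag addn0 gerBl ler0n.
    rewrite integral_cst// [X in (_ * X)%E](_ : _ = 1%E) ?mule1 ?ltry//.
    exact: probability_setT.
  - move=> n; rewrite /Phi /B addnS /S.
    apply: (potential_supermartingale m0 mX mU mV U1 (coinP _) (itemP _) ind l0
      (ltW q0) qp lpq).
    by apply: large; rewrite leq_addr.
exists (lim_sup_set B); split => //.
  by apply: bigcapT_measurable => n; apply: bigcup_measurable.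
move=> w; apply: contra_notP => wB.
have [n nB] : exists n, forall j, (n <= j)%N -> ~ B j w.
  apply: contrapT => /forallNP h; apply: wB => n _.
  have /existsNP[j /not_implyP[nj /contrapT Bj]] := h n.
  by exists j.
exists (t0 + n)%N => t tn.
have := nB (t - t0)%N; rewrite /B /= subnKC; last by lia.
move=> /(_ ltac:(lia)) lagt; apply: contraT => out; case: lagt.
(* An absent [y] has count 0, so its lag would be [q t], which is at least 1 since
   [(q - 1/m) t >= 1]. *)
rewrite /lag label_count_out// subr0.
have := large t ltac:(lia).
have := ler0n R t; have := ltW im0; nra.
Qed.

Unset Implicit Arguments. Set Strict Implicit.

Theorem theorem3 (d : measure_display) (T : measurableType d) (R : realType)
  (P : probability T R) (m : nat) (p : nat -> R)
  (X : nat -> T -> nat) (U V : nat -> T -> R) :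
  (0 < m)%N ->
  (forall j, 0 <= p j) ->
  (\sum_(0 <= j <oo) (p j)%:E = 1)%E ->
  (forall j, p j.+1 <= p j) ->
  (forall t (A : set nat), measurable (X t @^-1` A)) ->
  (forall t j, P (X t @^-1` [set j]) = (p j)%:E) ->
  (forall t, uniform01 P (U t)) ->
  (forall t, uniform01 P (V t)) ->
  stream_indep P X U V ->
  p 0%N > 1 / m%:R ->
  {ae P, forall w, exists t0 : nat, forall t : nat, (t0 <= t)%N ->
      uss_Z m (fun s => X s w) (fun s => U s w) (fun s => V s w) 0%N t}.
Proof.
move=> m0 _ _ _ mX itemP unifU unifV ind mp.
have mU t B : measurable B -> measurable (U t @^-1` B).
  by move=> mB; have := (unifU t).1 measurableT B mB; rewrite setTI.
have mV t B : measurable B -> measurable (V t @^-1` B).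
  by move=> mB; have := (unifV t).1 measurableT B mB; rewrite setTI.
(* Uniformity gives [U t < 1] only almost surely, while the invariants require it at every point.
   Clamping changes [U] on a null set only and, being measurable, preserves independence. *)
pose clamp (u : R) : R := if u < 1 then u else 0.
have mclamp B : measurable B -> measurable (clamp @^-1` B).
  have mc : measurable_fun [set: R] clamp.
    by apply: measurable_fun_ifT => //; apply: measurable_fun_ltr.
  by move=> mB; have := mc measurableT B mB; rewrite setTI.
pose U' t w := clamp (U t w).
have aeU : {ae P, forall w t, U' t w = U t w}.
  apply/ae_foralln => t; exists (~` [set w | U t w < 1]).
  have mlt := measurable_lt_preimage 1 (mU t).
  split; first exact: measurableC.
    transitivity (1 - P [set w | (U t w < 1)%R])%E.
      exact: probability_setC.
    have -> : P [set w | U t w < 1] = 1%E.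
      by apply: (unifU t).2; rewrite ler01 lexx.
    by rewrite subee.
  by move=> w /=; apply: contra_not => ltU; rewrite /U' /clamp ltU.
have aeZ := @ae_eventually_label _ T R P m 0 (p 0%N) X U' V m0 mX.
apply: filterS2 aeU (aeZ _ _ _ _ _ _ _) => //.
- move=> w UE [t0 evZ]; exists t0 => t /evZ.
  rewrite /uss_path /uss_Z (_ : U'^~ w = U^~ w)//.
  by apply/funext => s; exact: UE.
- by move=> t B mB; exact: (mU t _ (mclamp B mB)).
- by move=> t w; rewrite /U' /clamp; case: ifP.
- by move=> t; exact: (unifV t).2.
- move=> n A B C mB mC; apply: (ind n A (fun t => clamp @^-1` B t) C) => // t.
  exact: mclamp.
Qed.
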